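(* Let $m,n,r$ be positive integers with $r\le\min(m,n)$. Let $Y_0=U_0S_0V_0^\top$ with $U_0\in\mathbb{R}^{m\times r}$, $V_0\in\mathbb{R}^{n\times r}$, $U_0^\top U_0=V_0^\top V_0=I_r$, and $S_0\in\mathbb{R}^{r\times r}$ invertible. Let $\Delta A\in\mathbb{R}^{m\times n}$, and let $Y_1$ be the rank-admissible output of the reduced $K$-$L$ step started from $(U_0,S_0,V_0)$ with prescribed increment $\Delta A$. Let $Y_\star\in\mathbb{R}^{m\times n}$ and $Q\in\mathbb{R}^{r\times n}$ satisfy $Y_\star=(Y_\star V_0)Q$. Then $$\|Y_1-Y_\star\|\le(1+\|Q\|_2)\,\|Y_0+\Delta A-Y_\star\|.$$
   Context: $\|\cdot\|$ is the Frobenius norm and $\|\cdot\|_2$ the matrix operator norm. Reduced $K$-$L$ step, started from $(U_0,S_0,V_0)$ with increment $\Delta A$ (where $Y_0=U_0S_0V_0^\top$): (1) set $K_1:=U_0S_0+\Delta A\,V_0=(Y_0+\Delta A)V_0$ and compute a factorization $U_1\widehat S_1=K_1$, where $U_1\in\mathbb{R}^{m\times r}$ has orthonormal columns and $\widehat S_1\in\mathbb{R}^{r\times r}$; (2) set $L_1:=V_0S_0^\top U_0^\top U_1+\Delta A^\top U_1=(Y_0+\Delta A)^\top U_1$ and compute a factorization $V_1S_1^\top=L_1$, where $V_1\in\mathbb{R}^{n\times r}$ has orthonormal columns and $S_1\in\mathbb{R}^{r\times r}$. The output is $Y_1:=U_1S_1V_1^\top$. The step (and its output) is called rank-admissible when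 $\operatorname{rank}K_1=r$. *)

(* Defs.v *)
From mathcomp Require Import all_boot all_order all_algebra.
From mathcomp Require Import classical_sets reals.

Set Implicit Arguments.
Unset Strict Implicit.
Unset Printing Implicit Defensive.

Local Open Scope classical_set_scope.
Local Open Scope ring_scope.

Definition frobnorm (R : realType) (m n : nat) (A : 'M[R]_(m, n)) : R :=
  Num.sqrt (\sum_i \sum_j A i j ^+ 2).

(* On column vectors [frobnorm] is the Euclidean norm.  The set below contains
   0 and is bounded above by [frobnorm A], so [sup] is a genuine supremum. *)
Definition opnorm (R : realType) (m n : nat) (A : 'M[R]_(m, n)) : R :=
  sup [set frobnorm (A *m x) | x in [set x : 'cV[R]_n | frobnorm x <= 1]].

Definition orthonormal_cols (R : realType) (m r : nat) (U : 'M[R]_(m, r)) :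
  Prop := U^T *m U = 1%:M.

Definition K_factor (R : realType) (m n r : nat) (U0 : 'M[R]_(m, r))
    (S0 : 'M[R]_r) (V0 : 'M[R]_(n, r)) (dA : 'M[R]_(m, n)) : 'M[R]_(m, r) :=
  U0 *m S0 + dA *m V0.

Definition L_factor (R : realType) (m n r : nat) (U0 : 'M[R]_(m, r))
    (S0 : 'M[R]_r) (V0 : 'M[R]_(n, r)) (dA : 'M[R]_(m, n))
    (U1 : 'M[R]_(m, r)) : 'M[R]_(n, r) :=
  V0 *m S0^T *m U0^T *m U1 + dA^T *m U1.

(* The factorizations are not unique, so the step is a relation:
   [Y1] is an output for some choice of both factorizations. *)
Definition reduced_KL_step (R : realType) (m n r : nat) (U0 : 'M[R]_(m, r))
    (S0 : 'M[R]_r) (V0 : 'M[R]_(n, r)) (dA Y1 : 'M[R]_(m, n)) : Prop :=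
  exists (U1 : 'M[R]_(m, r)) (S1hat : 'M[R]_r)
         (V1 : 'M[R]_(n, r)) (S1 : 'M[R]_r),
    [/\ orthonormal_cols U1 /\ U1 *m S1hat = K_factor U0 S0 V0 dA,
        orthonormal_cols V1 /\ V1 *m S1^T = L_factor U0 S0 V0 dA U1
      & Y1 = U1 *m S1 *m V1^T].

Definition rank_admissible (R : realType) (m n r : nat) (U0 : 'M[R]_(m, r))
    (S0 : 'M[R]_r) (V0 : 'M[R]_(n, r)) (dA : 'M[R]_(m, n)) : Prop :=
  \rank (K_factor U0 S0 V0 dA) = r.

(* Main.v *)
Require Import Defs.
From mathcomp Require Import all_boot all_order all_algebra.
From mathcomp Require Import classical_sets reals.
From mathcomp Require Import ring lra.

(** Put [M := Y0 + dA], [E := M - Ystar] and let [P := U1 *m U1^T] be the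
    orthogonal projector onto the range of [U1].  The second half of the step
    only projects: [Y1 = P *m M].  The first half puts the columns of
    [K1 = M *m V0] in the range of [U1], so that [P] fixes them:
    [(1 - P) *m M *m V0 = 0].  Since [Ystar = Ystar *m V0 *m Q], the part of
    [Ystar] missed by [P] is therefore controlled by the error itself,
    [(1 - P) *m Ystar = - (1 - P) *m E *m V0 *m Q], and

      [Y1 - Ystar = P *m E + (1 - P) *m (E *m V0 *m Q)].

    The two summands are Frobenius-orthogonal, so Pythagoras
    ([frobnorm_projD_le]) bounds the norm of the sum by
    [frobnorm E + frobnorm (E *m V0 *m Q)].  Multiplying by [V0] does not
    increase the norm ([frobnorm_mulmx_orthonormal_le]), and multiplying by
    [Q] on the right costs at most [opnorm Q] ([frobnorm_mulmxr_le]).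

    As [opnorm] is a supremum over column vectors, it bounds multiplication on
    the left directly, column by column ([frobnorm_mulmxl_le]); the bound on
    the right comes from this one by the Cauchy-Schwarz inequality for the
    trace inner product ([frobdot_le]). *)

Import Order.TTheory GRing.Theory Num.Theory.

Set Implicit Arguments.
Unset Strict Implicit.
Unset Printing Implicit Defensive.

Local Open Scope ring_scope.

(** * The trace inner product *)

Section FrobeniusInnerProduct.
Variable R : realType.

Definition frobdot (m n : nat) (A B : 'M[R]_(m, n)) : R := \tr (A^T *m B).

Lemma frobdotE (m n : nat) (A B : 'M[R]_(m, n)) :
  frobdot A B = \sum_i \sum_j A i j * B i j.
Proof.
rewrite exchange_big /=; apply: eq_bigr => j _.
by rewrite mxE; apply: eq_bigr => i _; rewrite mxE.
Qed.

Lemma frobdotC (m n : nat) (A B : 'M[R]_(m, n)) : frobdot A B = frobdot B A.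
Proof. by rewrite /frobdot -mxtrace_tr trmx_mul trmxK. Qed.

Lemma frobdotDl (m n : nat) (A B C : 'M[R]_(m, n)) :
  frobdot (A + B) C = frobdot A C + frobdot B C.
Proof. by rewrite /frobdot !linearD /= mulmxDl linearD. Qed.

Lemma frobdotZl (m n : nat) (a : R) (A B : 'M[R]_(m, n)) :
  frobdot (a *: A) B = a * frobdot A B.
Proof. by rewrite /frobdot !linearZ /= -scalemxAl linearZ. Qed.

Lemma frobdotDr (m n : nat) (A B C : 'M[R]_(m, n)) :
  frobdot A (B + C) = frobdot A B + frobdot A C.
Proof. by rewrite !(frobdotC A) frobdotDl. Qed.

Lemma frobdotZr (m n : nat) (a : R) (A B : 'M[R]_(m, n)) :
  frobdot A (a *: B) = a * frobdot A B.
Proof. by rewrite !(frobdotC A) frobdotZl. Qed.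

Lemma frobdot_ge0 (m n : nat) (A : 'M[R]_(m, n)) : 0 <= frobdot A A.
Proof.
by rewrite frobdotE; apply: sumr_ge0 => i _; apply: sumr_ge0 => j _;
  rewrite -expr2 sqr_ge0.
Qed.

Lemma frobnormE (m n : nat) (A : 'M[R]_(m, n)) :
  frobnorm A = Num.sqrt (frobdot A A).
Proof.
by rewrite frobdotE; congr Num.sqrt; apply: eq_bigr => i _; apply: eq_bigr.
Qed.

Lemma frobnorm_ge0 (m n : nat) (A : 'M[R]_(m, n)) : 0 <= frobnorm A.
Proof. exact: sqrtr_ge0. Qed.

Lemma sqr_frobnorm (m n : nat) (A : 'M[R]_(m, n)) :
  frobnorm A ^+ 2 = frobdot A A.
Proof. by rewrite frobnormE sqr_sqrtr ?frobdot_ge0. Qed.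

Lemma sqr_frobnorm_sum (m n : nat) (A : 'M[R]_(m, n)) :
  frobnorm A ^+ 2 = \sum_i \sum_j A i j ^+ 2.
Proof.
by rewrite sqr_frobnorm frobdotE; apply: eq_bigr => i _; apply: eq_bigr.
Qed.

Lemma sqr_frobnorm_col (m n : nat) (A : 'M[R]_(m, n)) :
  frobnorm A ^+ 2 = \sum_j frobnorm (col j A) ^+ 2.
Proof.
rewrite sqr_frobnorm_sum exchange_big; apply: eq_bigr => j _.
by rewrite sqr_frobnorm_sum; apply: eq_bigr => i _; rewrite big_ord1 mxE.
Qed.

Lemma frobnorm0 (m n : nat) : frobnorm (0 : 'M[R]_(m, n)) = 0.
Proof. by rewrite frobnormE /frobdot mulmx0 mxtrace0 sqrtr0. Qed.

Lemma frobnorm_eq0 (m n : nat) (A : 'M[R]_(m, n)) : frobnorm A = 0 -> A = 0.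
Proof.
move=> A0; apply/matrixP=> i j; rewrite mxE.
have /eqP := sqr_frobnorm_sum A; rewrite A0 expr0n /= eq_sym.
rewrite psumr_eq0; last by move=> k _; apply: sumr_ge0 => l _; apply: sqr_ge0.
move=> /allP/(_ i (mem_index_enum _))/=.
rewrite psumr_eq0; last by move=> l _; apply: sqr_ge0.
by move=> /allP/(_ j (mem_index_enum _))/=; rewrite sqrf_eq0 => /eqP.
Qed.

Lemma frobnormZ (m n : nat) (a : R) (A : 'M[R]_(m, n)) :
  0 <= a -> frobnorm (a *: A) = a * frobnorm A.
Proof.
move=> a0; rewrite !frobnormE frobdotZl frobdotZr mulrA -expr2.
by rewrite sqrtrM ?sqr_ge0 // sqrtr_sqr ger0_norm.
Qed.

Lemma frobnorm_tr (m n : nat) (A : 'M[R]_(m, n)) : frobnorm A^T = frobnorm A.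
Proof. by rewrite !frobnormE /frobdot trmxK mxtrace_mulC. Qed.

(** Cauchy-Schwarz, from the nonnegativity of the square of
    [frobnorm B *: A - frobnorm A *: B]. *)
Lemma frobdot_le (m n : nat) (A B : 'M[R]_(m, n)) :
  frobdot A B <= frobnorm A * frobnorm B.
Proof.
have [/frobnorm_eq0 -> | a0] := eqVneq (frobnorm A) 0.
  by rewrite frobnorm0 mul0r /frobdot trmx0 mul0mx mxtrace0.
have [/frobnorm_eq0 -> | b0] := eqVneq (frobnorm B) 0.
  by rewrite frobnorm0 mulr0 /frobdot mulmx0 mxtrace0.
have ab_gt0 : 0 < frobnorm A * frobnorm B.
  by rewrite mulr_gt0 // lt0r frobnorm_ge0 ?a0 ?b0.
have := frobdot_ge0 (frobnorm B *: A + (- frobnorm A) *: B).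
rewrite !(frobdotDl, frobdotDr, frobdotZl, frobdotZr) (frobdotC B A).
rewrite -!sqr_frobnorm => h.
rewrite -(ler_pM2l ab_gt0) -subr_ge0; lra.
Qed.

Lemma frobnorm_outer (m n : nat) (y : 'cV[R]_m) (x : 'cV[R]_n) :
  frobnorm (y *m x^T) = frobnorm y * frobnorm x.
Proof.
rewrite !frobnormE -sqrtrM ?frobdot_ge0 //; congr Num.sqrt.
rewrite !frobdotE big_distrl /=; apply: eq_bigr => i _.
rewrite big_ord1 big_distrr /=; apply: eq_bigr => j _.
by rewrite !mxE !big_ord1 !mxE; ring.
Qed.

Lemma frobdot_mulmxl (m n p : nat) (A : 'M[R]_(m, n)) (X : 'M[R]_(n, p))
    (B : 'M[R]_(m, p)) : frobdot (A *m X) B = frobdot A (B *m X^T).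
Proof. by rewrite /frobdot trmx_mul -mulmxA mxtrace_mulC mulmxA. Qed.

Lemma le_of_sqr_le_mul (a b : R) : 0 <= a -> 0 <= b -> a ^+ 2 <= b * a -> a <= b.
Proof.
rewrite le_eqVlt => /predU1P[<- //|a_gt0] _.
by rewrite expr2 ler_pM2r.
Qed.

(** * The operator norm bounds multiplication *)

(** A crude bound, whose role is to make the supremum defining [opnorm] a
    genuine one.  It is Cauchy-Schwarz applied to
    [frobnorm (A *m x) ^+ 2 = frobdot A (A *m x *m x^T)]. *)
Lemma frobnorm_mulmx_cV_le (m n : nat) (A : 'M[R]_(m, n)) (x : 'cV[R]_n) :
  frobnorm (A *m x) <= frobnorm A * frobnorm x.
Proof.
apply: le_of_sqr_le_mul; rewrite ?mulr_ge0 ?frobnorm_ge0 //.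
rewrite sqr_frobnorm frobdot_mulmxl (le_trans (frobdot_le _ _)) //.
by rewrite frobnorm_outer (mulrC (frobnorm (A *m x))) mulrA.
Qed.

Lemma opnorm_ubound (m n : nat) (A : 'M[R]_(m, n)) (x : 'cV[R]_n) :
  frobnorm x <= 1 -> frobnorm (A *m x) <= opnorm A.
Proof.
move=> x1; apply: ub_le_sup; last by exists x.
exists (frobnorm A) => _ [y y1 <-].
rewrite (le_trans (frobnorm_mulmx_cV_le A y)) //.
by rewrite ler_piMr ?frobnorm_ge0.
Qed.

Lemma opnorm_ge0 (m n : nat) (A : 'M[R]_(m, n)) : 0 <= opnorm A.
Proof.
by rewrite -(frobnorm0 m 1) -(mulmx0 _ A) opnorm_ubound // frobnorm0 ler01.
Qed.

Lemma opnorm_mulmx_cV_le (m n : nat) (A : 'M[R]_(m, n)) (x : 'cV[R]_n) :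
  frobnorm (A *m x) <= opnorm A * frobnorm x.
Proof.
have [/frobnorm_eq0 -> | x0] := eqVneq (frobnorm x) 0.
  by rewrite mulmx0 !frobnorm0 mulr0.
have x_gt0 : 0 < frobnorm x by rewrite lt0r x0 frobnorm_ge0.
have xV_ge0 : 0 <= (frobnorm x)^-1 by rewrite invr_ge0 ltW.
rewrite -ler_pdivrMr // mulrC -frobnormZ // scalemxAr opnorm_ubound //.
by rewrite frobnormZ // mulVf.
Qed.

Lemma frobnorm_mulmxl_le (m n p : nat) (A : 'M[R]_(m, n)) (X : 'M[R]_(n, p)) :
  frobnorm (A *m X) <= opnorm A * frobnorm X.
Proof.
rewrite -ler_sqr ?nnegrE ?mulr_ge0 ?frobnorm_ge0 ?opnorm_ge0 //.
rewrite exprMn !sqr_frobnorm_col big_distrr /=.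
apply: ler_sum => j _; rewrite -exprMn ler_sqr ?nnegrE ?frobnorm_ge0 //.
  by rewrite colE -mulmxA -colE opnorm_mulmx_cV_le.
by rewrite mulr_ge0 ?opnorm_ge0 ?frobnorm_ge0.
Qed.

(** This is the left bound for the adjoint, obtained without comparing
    [opnorm Q] and [opnorm Q^T]: moving [B] across the inner product turns
    [frobnorm (B *m Q) ^+ 2] into [frobdot B^T (Q *m (B *m Q)^T)], where [Q]
    acts from the left. *)
Lemma frobnorm_mulmxr_le (m n p : nat) (B : 'M[R]_(m, n)) (Q : 'M[R]_(n, p)) :
  frobnorm (B *m Q) <= opnorm Q * frobnorm B.
Proof.
apply: le_of_sqr_le_mul; rewrite ?mulr_ge0 ?frobnorm_ge0 ?opnorm_ge0 //.
have -> : frobnorm (B *m Q) ^+ 2 = frobdot B^T (Q *m (B *m Q)^T).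
  by rewrite sqr_frobnorm /frobdot mxtrace_mulC trmxK mulmxA.
rewrite (le_trans (frobdot_le _ _)) // frobnorm_tr mulrAC mulrC.
rewrite ler_wpM2r ?frobnorm_ge0 //.
by rewrite (le_trans (frobnorm_mulmxl_le _ _)) // frobnorm_tr.
Qed.

(** * Orthogonal projection *)

Lemma sqr_frobnormD_orth (m n : nat) (A B : 'M[R]_(m, n)) :
  A^T *m B = 0 ->
  frobnorm (A + B) ^+ 2 = frobnorm A ^+ 2 + frobnorm B ^+ 2.
Proof.
move=> AB0; have AB : frobdot A B = 0 by rewrite /frobdot AB0 mxtrace0.
rewrite !sqr_frobnorm frobdotDl !frobdotDr (frobdotC B A) AB.
by rewrite addr0 add0r.
Qed.

Section Projector.
Variables (m r : nat) (U : 'M[R]_(m, r)).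
Hypothesis U_orth : orthonormal_cols U.

Lemma proj_orthonormal_orth (n : nat) (X Y : 'M[R]_(m, n)) :
  (U *m U^T *m X)^T *m (Y - U *m U^T *m Y) = 0.
Proof.
rewrite !trmx_mul trmxK -!mulmxA !mulmxBr !mulmxA.
by rewrite -(mulmxA _ U^T U) U_orth mulmx1 subrr.
Qed.

Lemma frobnorm_mul_orthonormal (n : nat) (X : 'M[R]_(r, n)) :
  frobnorm (U *m X) = frobnorm X.
Proof.
by rewrite !frobnormE /frobdot trmx_mul mulmxA -(mulmxA _ U^T U) U_orth mulmx1.
Qed.

Lemma sqr_frobnorm_proj (n : nat) (X : 'M[R]_(m, n)) :
  frobnorm X ^+ 2 =
  frobnorm (U *m U^T *m X) ^+ 2 + frobnorm (X - U *m U^T *m X) ^+ 2.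
Proof.
by rewrite -sqr_frobnormD_orth ?proj_orthonormal_orth // addrC subrK.
Qed.

Lemma frobnorm_mulmx_orthonormal_le (n : nat) (X : 'M[R]_(n, m)) :
  frobnorm (X *m U) <= frobnorm X.
Proof.
rewrite -(frobnorm_tr X) -frobnorm_tr trmx_mul -frobnorm_mul_orthonormal mulmxA.
rewrite -ler_sqr ?nnegrE ?frobnorm_ge0 //.
by rewrite (sqr_frobnorm_proj X^T) lerDl sqr_ge0.
Qed.

Lemma frobnorm_projD_le (n : nat) (X Y : 'M[R]_(m, n)) :
  frobnorm (U *m U^T *m X + (Y - U *m U^T *m Y)) <= frobnorm X + frobnorm Y.
Proof.
have XY_ge0 : 0 <= frobnorm X * frobnorm Y by rewrite mulr_ge0 ?frobnorm_ge0.
rewrite -ler_sqr ?nnegrE ?addr_ge0 ?frobnorm_ge0 //.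
rewrite sqr_frobnormD_orth ?proj_orthonormal_orth //.
have PY := sqr_ge0 (frobnorm (U *m U^T *m Y)).
have QX := sqr_ge0 (frobnorm (X - U *m U^T *m X)).
rewrite sqrrD; have := sqr_frobnorm_proj X; have := sqr_frobnorm_proj Y; lra.
Qed.

End Projector.

End FrobeniusInnerProduct.

(** * The reduced step *)

Section ReducedStep.
Variables (R : realType) (m n r : nat).
Variables (U0 : 'M[R]_(m, r)) (S0 : 'M[R]_r) (V0 : 'M[R]_(n, r)).
Variable dA : 'M[R]_(m, n).

Lemma K_factorE :
  orthonormal_cols V0 -> K_factor U0 S0 V0 dA = (U0 *m S0 *m V0^T + dA) *m V0.
Proof.
by move=> V0_orth; rewrite mulmxDl -(mulmxA _ V0^T V0) V0_orth mulmx1.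
Qed.

Lemma L_factorE (U1 : 'M[R]_(m, r)) :
  L_factor U0 S0 V0 dA U1 = (U0 *m S0 *m V0^T + dA)^T *m U1.
Proof. by rewrite linearD /= mulmxDl !trmx_mul trmxK !mulmxA. Qed.

(** The factors that are not unique disappear: the step projects [Y0 + dA]
    onto a subspace that contains the range of [(Y0 + dA) *m V0], because
    [V1 *m S1^T = L1] gives [S1 *m V1^T = U1^T *m (Y0 + dA)] and
    [K1 = U1 *m S1hat] is fixed by [U1 *m U1^T]. *)
Lemma reduced_KL_step_proj (Y1 : 'M[R]_(m, n)) :
  orthonormal_cols V0 -> reduced_KL_step U0 S0 V0 dA Y1 ->
  let M := U0 *m S0 *m V0^T + dA in
  exists U1 : 'M[R]_(m, r),
    [/\ orthonormal_cols U1, Y1 = U1 *m U1^T *m M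
      & U1 *m U1^T *m (M *m V0) = M *m V0].
Proof.
move=> V0_orth [U1 [S1hat [V1 [S1 [[U1_orth K1] [_ L1] ->]]]]] M.
exists U1; split=> //.
  move: L1; rewrite L_factorE => /(congr1 trmx).
  by rewrite !trmx_mul !trmxK -(mulmxA U1 S1) => ->; rewrite mulmxA.
move: K1; rewrite K_factorE // => <-.
by rewrite mulmxA -(mulmxA U1) U1_orth mulmx1.
Qed.

End ReducedStep.

Theorem theorem4p1 (R : realType) (m n r : nat)
    (hm : (0 < m)%N) (hn : (0 < n)%N) (hr : (0 < r)%N)
    (hrmn : (r <= minn m n)%N)
    (U0 : 'M[R]_(m, r)) (S0 : 'M[R]_r) (V0 : 'M[R]_(n, r))
    (Y0 dA Y1 Ystar : 'M[R]_(m, n)) (Q : 'M[R]_(r, n))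
    (hU0 : orthonormal_cols U0) (hV0 : orthonormal_cols V0)
    (hS0 : S0 \in unitmx)
    (hY0 : Y0 = U0 *m S0 *m V0^T)
    (hY1 : reduced_KL_step U0 S0 V0 dA Y1)
    (hadm : rank_admissible U0 S0 V0 dA)
    (hYstar : Ystar = (Ystar *m V0) *m Q) :
  frobnorm (Y1 - Ystar) <= (1 + opnorm Q) * frobnorm (Y0 + dA - Ystar).
Proof.
have [U1 [U1_orth -> PMV]] := reduced_KL_step_proj hV0 hY1.
rewrite -hY0 in PMV *; set M := Y0 + dA in PMV *; set P := U1 *m U1^T in PMV *.
set E := M - Ystar; set F := E *m V0 *m Q.
have FE : F = M *m V0 *m Q - Ystar by rewrite /F /E !mulmxBl -hYstar.
(* P fixes M *m V0 *m Q, so that part of F cancels in F - P *m F. *)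
have -> : P *m M - Ystar = P *m E + (F - P *m F).
  rewrite FE !mulmxBr (mulmxA P (M *m V0)) PMV.
  by rewrite opprB (addrC (_ - Ystar)) !subrKA.
rewrite mulrDl mul1r (le_trans (frobnorm_projD_le U1_orth _ _)) // lerD2l.
rewrite (le_trans (frobnorm_mulmxr_le _ _)) // ler_wpM2l ?opnorm_ge0 //.
exact: frobnorm_mulmx_orthonormal_le.
Qed.
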